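(* Let $k\ge3$ be an integer, let $\lambda\in\mathbb{C}\setminus\{-n/2:n\in\mathbb{N}\}$, and let $\{p_n\}_{n\ge0}$ be the monic sieved OPS of the first kind: $p_0=1$ and $p_n(x)=\vartheta_{n-1}c_n^\lambda(x;k)$ for $n\ge1$, with $\vartheta_n:=(2\lambda+1)_{\lfloor n/k\rfloor}/\{2^n(\lambda+1)_{\lfloor n/k\rfloor}\}$. Then for all $n\ge1$ and $0\le j\le k-1$ the polynomial $p_{nk+j}$ satisfies the second order differential equation $$J_{nk+j}(x)p_{nk+j}''(x)+K_{nk+j}(x)p_{nk+j}'(x)+L_{nk+j}(x)p_{nk+j}(x)=0,$$ where $$J_{nk+j}=\Phi M_{nk+j},\qquad K_{nk+j}=\Psi M_{nk+j}-\Phi M_{nk+j}',$$ $$L_{nk+j}=N_{nk+j}M_{nk+j}'+\big(\Omega_j-N_{nk+j}'\big)M_{nk+j},$$ with $$\Phi(x)=(1-x^2)\widehat U_{k-1}(x),\qquad \Psi(x)=-k(2\lambda+1)\widehat T_k(x),$$ $$\Omega_j(x)=(nk+j+1)(nk+j+2\lambda k)\widehat U_{k-1}(x)+\tfrac{\lambda k}{2}\widehat U_{j-1}(x)\widehat U_{k-j-2}(x),$$ $$M_{nk+j}(x)=-2(nk+j+\lambda k)\widehat U_{k-1}(x)-\tfrac{\lambda k}{2}\big(\widehat U_{j-1}(x)\widehat U_{k-j-2}(x)-\widehat U_{j-2}(x)\widehat U_{k-j-1}(x)\big),$$ $$N_{nk+j}(x)=(nk+j+2\lambda k)\,x\,\widehat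 U_{k-1}(x)-\lambda k\,\epsilon_j\,\widehat U_{k-2}(x)+\tfrac{\lambda k}{8}\big(\widehat U_{j-1}(x)\widehat U_{k-j-3}(x)-\widehat U_{j-2}(x)\widehat U_{k-j-2}(x)\big),$$ and $\epsilon_{k-1}:=1$, $\epsilon_0:=0$, $\epsilon_j:=\frac12$ for $1\le j\le k-2$.
   Context: $\mathbb{N}=\{1,2,\dots\}$. $(\alpha)_0:=1$ and $(\alpha)_n:=\alpha(\alpha+1)\cdots(\alpha+n-1)$ for $n\ge1$. OPS = orthogonal polynomial sequence (with respect to a regular linear functional on complex polynomials). The polynomial $\Omega_j$ depends also on $n$. Chebyshev polynomials: $T_n(\cos\theta)=\cos n\theta$, $U_n(\cos\theta)=\sin((n+1)\theta)/\sin\theta$; monic versions $\widehat T_n:=2^{1-n}T_n$ ($n\ge1$), $\widehat U_n:=2^{-n}U_n$ ($n\ge0$), and by convention $\widehat U_n:=0$ for every negative index $n$. Sieved ultraspherical polynomials of the first kind: the polynomials $C_n(x;\beta|q)$ are defined by $C_0(x;\beta|q)=1$, $C_1(x;\beta|q)=2x(1-\beta)/(1-q)$ and, for $n\ge 1$, $2x(1-\beta q^n)C_n=(1-q^{n+1})C_{n+1}+(1-\beta^2q^{n-1})C_{n-1}$, with $|q|<1$. They are renormalized as $C_n(x;\beta|q)=\frac{(\beta^2;q)_n}{(q;q)_n}c_n(x;\beta|q)$, where $(a;q)_0:=1$, $(a;q)_n:=\prod_{j=1}^n(1-aq^{j-1})$; equivalently $c_0=1$, $c_1=2x/(1+\beta)$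 and $2x(1-\beta q^n)c_n=(1-\beta^2q^n)c_{n+1}+(1-q^n)c_{n-1}$ for $n\ge1$ (this form is used also when $\beta=1$, i.e. $\lambda=0$). With $\omega_k:=e^{2\pi i/k}$, $c_n^\lambda(x;k):=\lim_{s\to1}c_n(x;s^{\lambda k}\,|\,s\omega_k)$ (limit over $s\in(0,1)$). Equivalently, the monic polynomials $p_n$ satisfy $p_0=1$, $p_1=x$, $p_{N+1}=xp_N-\gamma_Np_{N-1}$ ($N\ge1$), where $\gamma_{mk}=\frac{m}{4(m+\lambda)}$ and $\gamma_{mk+1}=\frac{m+2\lambda}{4(m+\lambda)}$ for $m\ge1$, $\gamma_1=\frac12$, and $\gamma_N=\frac14$ for all other $N\ge1$. *)

(* Defs.v *)
From HB Require Import structures.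
From mathcomp Require Import all_boot all_order all_algebra.
From mathcomp Require Import all_classical all_reals all_analysis.
From mathcomp.real_closed Require Import complex.
From mathcomp Require Import ring.

Set Implicit Arguments.
Unset Strict Implicit.
Unset Printing Implicit Defensive.

Import Order.TTheory GRing.Theory Num.Theory.
Import numFieldNormedType.Exports.

Local Open Scope classical_set_scope.
Local Open Scope ring_scope.
Local Open Scope complex_scope.

Definition poch (F : fieldType) (a : F) (n : nat) : F :=
  \prod_(i < n) (a + i%:R).

Definition qpoch (F : fieldType) (a q : F) (n : nat) : F :=
  \prod_(1 <= j < n.+1) (1 - a * q ^+ j.-1).

(* Chebyshev polynomials, by recurrence; chebT_cos and chebU_sin below state
   the trigonometric characterizations. *)
Fixpoint chebT (F : fieldType) (n : nat) : {poly F} :=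
  match n with
  | 0 => 1
  | m.+1 => match m with
            | 0 => 'X
            | l.+1 => 2 *: ('X * chebT F m) - chebT F l
            end
  end.

Fixpoint chebU (F : fieldType) (n : nat) : {poly F} :=
  match n with
  | 0 => 1
  | m.+1 => match m with
            | 0 => 2 *: 'X
            | l.+1 => 2 *: ('X * chebU F m) - chebU F l
            end
  end.

Definition That (F : fieldType) (n : nat) : {poly F} :=
  (2 / 2 ^+ n) *: chebT F n.

(* The index is an integer: negative indices give 0 by convention (this is
   not the extension of the recurrence, for which U_(-2) = -1). *)
Definition Uhat (F : fieldType) (i : int) : {poly F} :=
  match i with
  | Posz n => 2 ^- n *: chebU F n
  | Negz _ => 0
  end.

(* C_n(x; beta | q) *)
Fixpoint ultraC (F : fieldType) (beta q : F) (n : nat) : {poly F} :=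
  match n with
  | 0 => 1
  | m.+1 => match m with
            | 0 => (2 * (1 - beta) / (1 - q)) *: 'X
            | l.+1 =>
                (1 - q ^+ m.+1)^-1 *:
                  ((2 * (1 - beta * q ^+ m)) *: ('X * ultraC beta q m)
                   - (1 - beta ^+ 2 * q ^+ l) *: ultraC beta q l)
            end
  end.

(* c_n(x; beta | q), from 2x(1 - beta q^m) c_m
     = (1 - beta^2 q^m) c_(m+1) + (1 - q^m) c_(m-1);
   unlike C_n = (beta^2; q)_n / (q; q)_n c_n (ultraC_c below), this also
   determines c_n when beta = 1. *)
Fixpoint ultrac (F : fieldType) (beta q : F) (n : nat) : {poly F} :=
  match n with
  | 0 => 1
  | m.+1 => match m with
            | 0 => (2 / (1 + beta)) *: 'X
            | l.+1 =>
                (1 - beta ^+ 2 * q ^+ m)^-1 *: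
                  ((2 * (1 - beta * q ^+ m)) *: ('X * ultrac beta q m)
                   - (1 - q ^+ m) *: ultrac beta q l)
            end
  end.

Definition cexp (R : realType) (z : R[i]) : R[i] :=
  (expR (complex.Re z))%:C * (cos (complex.Im z) +i* sin (complex.Im z)).

(* s ^ z for s > 0 *)
Definition cpow (R : realType) (s : R) (z : R[i]) : R[i] :=
  cexp (z * (ln s)%:C).

Definition omega (R : realType) (k : nat) : R[i] :=
  cexp (0 +i* (2 * pi / k%:R)).

(* c_n^lam(x; k), a limit in the complex plane (R[i]^o carries the topology
   of the norm of R[i]) for s -> 1, s < 1. *)
Definition sieved_c (R : realType) (lam : R[i]) (k n : nat) (x : R[i])
  : R[i] :=
  lim (((ultrac (cpow s (lam * k%:R)) (s%:C * omega R k) n).[x] : R[i]^o)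
         @[s --> (1 : R)^'-]).

Definition vartheta (F : fieldType) (lam : F) (k n : nat) : F :=
  poch (2 * lam + 1) (n %/ k) / (2 ^+ n * poch (lam + 1) (n %/ k)).

Definition PhiP (F : fieldType) (k : nat) : {poly F} :=
  (1 - 'X^2) * Uhat F (k%:Z - 1).

Definition PsiP (F : fieldType) (lam : F) (k : nat) : {poly F} :=
  - (k%:R * (2 * lam + 1)) *: That F k.

Definition OmegaP (F : fieldType) (lam : F) (k n j : nat) : {poly F} :=
  (((n * k + j + 1)%:R * ((n * k + j)%:R + 2 * lam * k%:R))
     *: Uhat F (k%:Z - 1))
  + (lam * k%:R / 2) *: (Uhat F (j%:Z - 1) * Uhat F (k%:Z - j%:Z - 2)).

Definition MP (F : fieldType) (lam : F) (k n j : nat) : {poly F} :=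
  - (2 * ((n * k + j)%:R + lam * k%:R)) *: Uhat F (k%:Z - 1)
  - (lam * k%:R / 2) *:
      (Uhat F (j%:Z - 1) * Uhat F (k%:Z - j%:Z - 2)
       - Uhat F (j%:Z - 2) * Uhat F (k%:Z - j%:Z - 1)).

Definition eps (F : fieldType) (k j : nat) : F :=
  if j == k.-1 then 1 else if j == 0 then 0 else 1 / 2.

Definition NP (F : fieldType) (lam : F) (k n j : nat) : {poly F} :=
  ((n * k + j)%:R + 2 * lam * k%:R) *: ('X * Uhat F (k%:Z - 1))
  - (lam * k%:R * eps F k j) *: Uhat F (k%:Z - 2)
  + (lam * k%:R / 8) *:
      (Uhat F (j%:Z - 1) * Uhat F (k%:Z - j%:Z - 3)
       - Uhat F (j%:Z - 2) * Uhat F (k%:Z - j%:Z - 2)).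

Definition JP (F : fieldType) (lam : F) (k n j : nat) : {poly F} :=
  PhiP F k * MP lam k n j.

Definition KP (F : fieldType) (lam : F) (k n j : nat) : {poly F} :=
  PsiP lam k * MP lam k n j - PhiP F k * (MP lam k n j)^`().

Definition LP (F : fieldType) (lam : F) (k n j : nat) : {poly F} :=
  NP lam k n j * (MP lam k n j)^`()
  + (OmegaP lam k n j - (NP lam k n j)^`()) * MP lam k n j.

Lemma chebT_cos (R : realType) (n : nat) (t : R) :
  (chebT R[i] n).[(cos t)%:C] = (cos (n%:R * t))%:C.
Proof.
suff: (chebT R[i] n).[(cos t)%:C] = (cos (n%:R * t))%:C /\
  (chebT R[i] n.+1).[(cos t)%:C] = (cos (n.+1%:R * t))%:C by case.
elim: n => [|n [IH0 IH1]].
  by rewrite /= hornerC hornerX mul0r cos0 mul1r.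
split=> //.
have -> : chebT R[i] n.+2 = 2 *: ('X * chebT R[i] n.+1) - chebT R[i] n by [].
rewrite hornerD hornerN hornerZ hornerM hornerX IH0 IH1.
have -> : n.+2%:R * t = n.+1%:R * t + t by rewrite -[n.+2%:R]natr1; ring.
have -> : n%:R * t = n.+1%:R * t - t by rewrite -[n.+1%:R]natr1; ring.
rewrite !cosD cosN sinN -(rmorph_nat (real_complex R)) -!rmorphM -rmorphB.
by congr (_%:C); ring.
Qed.

Lemma chebU_sin (R : realType) (n : nat) (t : R) :
  (chebU R[i] n).[(cos t)%:C] * (sin t)%:C = (sin (n.+1%:R * t))%:C.
Proof.
suff: (chebU R[i] n).[(cos t)%:C] * (sin t)%:C = (sin (n.+1%:R * t))%:C /\
  (chebU R[i] n.+1).[(cos t)%:C] * (sin t)%:C = (sin (n.+2%:R * t))%:C by case.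
elim: n => [|n [IH0 IH1]].
  rewrite /= hornerC hornerZ hornerX !mul1r; split=> //.
  have -> : 2 * t = t + t by ring.
  rewrite sinD -(rmorph_nat (real_complex R)) -!rmorphM.
  by congr (_%:C); ring.
split=> //.
have -> : chebU R[i] n.+2 = 2 *: ('X * chebU R[i] n.+1) - chebU R[i] n by [].
rewrite hornerD hornerN hornerZ hornerM hornerX mulrBl IH0.
rewrite -!mulrA IH1.
have -> : n.+3%:R * t = n.+2%:R * t + t by rewrite -[n.+3%:R]natr1; ring.
have -> : n.+1%:R * t = n.+2%:R * t - t by rewrite -[n.+2%:R]natr1; ring.
rewrite !sinD cosN sinN -(rmorph_nat (real_complex R)) -!rmorphM -rmorphB.
by congr (_%:C); ring.
Qed.

Lemma ultraC_c (F : fieldType) (beta q : F) (n : nat) :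
  (forall m, (0 < m)%N -> q ^+ m != 1) ->
  (forall m, beta ^+ 2 * q ^+ m != 1) ->
  ultraC beta q n = (qpoch (beta ^+ 2) q n / qpoch q q n) *: ultrac beta q n.
Proof.
move=> hq hb.
suff: ultraC beta q n = (qpoch (beta ^+ 2) q n / qpoch q q n) *: ultrac beta q n
  /\ ultraC beta q n.+1 =
     (qpoch (beta ^+ 2) q n.+1 / qpoch q q n.+1) *: ultrac beta q n.+1 by case.
have hq0 m : 1 - q ^+ m.+1 != 0 by rewrite subr_eq0 eq_sym hq.
have hb0 m : 1 - beta ^+ 2 * q ^+ m != 0 by rewrite subr_eq0 eq_sym hb.
have qpS a m : qpoch a q m.+1 = qpoch a q m * (1 - a * q ^+ m).
  by rewrite /qpoch big_nat_recr.
have qq0 m : qpoch q q m != 0.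
  by elim: m => [|m IH];
    rewrite ?qpS ?mulf_neq0 -?exprS // /qpoch big_geq // oner_neq0.
have q00 a : qpoch a q 0 = 1 by rewrite /qpoch big_geq.
elim: n => [|n [IH0 IH1]].
  rewrite !qpS !q00 /= divr1 scale1r !expr0 scalerA; split=> //.
  have := hb0 0; have := hq0 0; rewrite expr0 expr1 !mulr1 => h1 h2.
  have h3 : (1 + beta) * (1 - beta) != 0.
    by have -> : (1 + beta) * (1 - beta) = 1 - beta ^+ 2 by ring.
  have h4 : 1 + beta != 0 by apply: contraNneq h3 => ->; rewrite mul0r.
  by congr (_ *: _); field; rewrite h4 h1.
split=> //.
have -> : ultraC beta q n.+2 = (1 - q ^+ n.+2)^-1 *:
    ((2 * (1 - beta * q ^+ n.+1)) *: ('X * ultraC beta q n.+1)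
     - (1 - beta ^+ 2 * q ^+ n) *: ultraC beta q n) by [].
have -> : ultrac beta q n.+2 = (1 - beta ^+ 2 * q ^+ n.+1)^-1 *:
    ((2 * (1 - beta * q ^+ n.+1)) *: ('X * ultrac beta q n.+1)
     - (1 - q ^+ n.+1) *: ultrac beta q n) by [].
rewrite IH0 IH1 -scalerAr !scalerBr !scalerA.
rewrite [qpoch _ _ n.+2]qpS [qpoch q q n.+2]qpS.
rewrite [qpoch _ _ n.+1]qpS [qpoch q q n.+1]qpS -!exprS.
have h1 := hq0 n.+1; have h2 := hq0 n; have h3 := hb0 n.+1; have h4 := qq0 n.
move: h1 h2 h3; set a := 1 - q ^+ n.+2; set b := 1 - q ^+ n.+1.
set d := 1 - _ * q ^+ n.+1 => h1 h2 h3.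
by congr (_ *: _ - _ *: _); field; rewrite ?h1 ?h2 ?h3 ?h4.
Qed.

(* Main.v *)
Require Import Defs.
From HB Require Import structures.
From mathcomp Require Import all_boot all_order all_algebra.
From mathcomp Require Import all_classical all_reals all_analysis.
From mathcomp.real_closed Require Import complex.
From mathcomp Require Import ring lra zify.

(** Why the theorem is true.

    Letting s tend to 1 in the recurrence of the continuous q-ultraspherical
    polynomials, every ratio of factors 1 - s^a omega_k^m tends to 1 when k does
    not divide m, and to a quotient of exponents when it does
    ([ultrac_coef_cvg]).  Hence p_0 = 1, p_1 = x and
    p_(N+2) = x p_(N+1) - gamma_(N+1) p_N, where gamma_N is 1/4 unless N is 0 or
    1 modulo k ([sieved_c_rec], [vartheta_step], [vartheta_gam]).

    From this recurrence on, the argument is the classical one for semiclassical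
    orthogonal polynomials.  Writing M_N, N_N, Omega_N for the polynomials of the
    statement with N = nk + j, and G = Phi' - Psi, three relations hold for
    all N >= 0:

      (a)  x M_(N+1) + N_N + N_(N+1) = G,
      (b)  Phi + x (N_(N+1) - N_N) = gamma_(N+1) M_N - gamma_(N+2) M_(N+2),
      (c)  Omega_(N+1) = Omega_N - M_(N+1).

    By induction on N, (a) and (b) give the pair of structure relations

      Phi p_N' = N_N p_N + M_N p_(N+1),
      Phi p_(N+1)' = (G - N_N) p_(N+1) - gamma_(N+1) M_(N+1) p_N,

    and (a), (b), (c) give the determinant of this first order system
    ([structure_relation], [determinant_relation]):

      (G - N_N) N_N + gamma_(N+1) M_(N+1) M_N = Phi Omega_N.

    Eliminating p_(N+1) between the two structure relations produces a second
    order equation for p_N; the determinant identity is what makes it divisible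
    by Phi, and the quotient is the stated equation ([ode_of_structure]).

    The relations (a), (b), (c) are identities between Chebyshev polynomials.
    With V_m the monic Chebyshev polynomial of the second kind of degree m - 1
    and l = k - 1 - j, the addition formula
    V_(j+l+1) = V_(j+1) V_(l+1) - V_j V_l / 4 makes every polynomial involved
    bilinear in (V_j, V_(j+1)) and (V_l, V_(l+1)), up to factors x and 1 - x^2;
    in this form the identities are checked by ring normalization.  The values
    of gamma at N = 0, 1 modulo k compensate the irregular shape of M_N at
    j = 0. *)

Set Implicit Arguments.
Unset Strict Implicit.
Unset Printing Implicit Defensive.

Import Order.TTheory GRing.Theory Num.Theory.
Import numFieldNormedType.Exports.

Local Open Scope classical_set_scope.
Local Open Scope ring_scope.
Local Open Scope complex_scope.

(** * Limits of complex powers *)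

Lemma cexpD (R : realType) (z w : R[i]) : cexp (z + w) = cexp z * cexp w.
Proof.
case: z w => [a b] [c d]; rewrite /cexp /= expRD cosD sinD; simpc.
by congr (_ +i* _); ring.
Qed.
(** Convergence in the complex plane is reached only through this embedding: every
    complex limit below is assembled from real limits and field operations. *)
Lemma cvg_real_complex (R : realType) (T : Type) (F : set_system T) {FF : Filter F}
    (f : T -> R) (a : R) :
  f x @[x --> F] --> a -> ((f x)%:C : R[i]^o) @[x --> F] --> (a%:C : R[i]^o).
Proof.
move=> fa; apply/cvgrPdist_lt => e e0.
have re0 : 0 < complex.Re e by move: e0; rewrite ltcE => /andP[].
have ee : e = (complex.Re e)%:C.
  by move: e0; case: e {re0} => u v; rewrite ltcE /= => /andP[/eqP -> _].
move/cvgrPdist_lt: fa => /(_ _ re0); apply: filterS => x.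
by rewrite -rmorphB normc_def /= expr0n addr0 sqrtr_sqr [in X in _ -> X]ee ltcR.
Qed.

Lemma cvg_complexM (R : realType) (T : Type) (F : set_system T) {FF : Filter F}
    (f g : T -> R[i]) (a b : R[i]) :
  (f x : R[i]^o) @[x --> F] --> (a : R[i]^o) -> (g x : R[i]^o) @[x --> F] --> (b : R[i]^o) ->
  (f x * g x : R[i]^o) @[x --> F] --> (a * b : R[i]^o).
Proof. exact: (@cvgM R[i] T F FF f g a b). Qed.
Lemma cvg_complexD (R : realType) (T : Type) (F : set_system T) {FF : Filter F}
    (f g : T -> R[i]) (a b : R[i]) :
  (f x : R[i]^o) @[x --> F] --> (a : R[i]^o) -> (g x : R[i]^o) @[x --> F] --> (b : R[i]^o) ->
  (f x + g x : R[i]^o) @[x --> F] --> (a + b : R[i]^o).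
Proof. exact: (@cvgD R[i] R[i]^o T F FF f g a b). Qed.
Lemma cvg_complexV (R : realType) (T : Type) (F : set_system T) {FF : Filter F}
    (f : T -> R[i]) (a : R[i]) : a != 0 ->
  (f x : R[i]^o) @[x --> F] --> (a : R[i]^o) -> 
  ((f x)^-1 : R[i]^o) @[x --> F] --> (a^-1 : R[i]^o).
Proof. exact: (@cvgV R[i] T F FF f a). Qed.
Lemma is_derive_scale (R : realType) (x w : R) : is_derive x 1 (fun t : R => w * t) w.
Proof.
have h : is_derive x 1 (w \*: (id : R -> R)) (w *: 1) by exact: is_deriveZ.
by rewrite -[X in is_derive _ _ _ X]mulr1; exact: h.
Qed.

Lemma is_derive0_quotient (R : realType) (f : R -> R) (d : R) :
  is_derive (0 : R) 1 f d -> (f t - f 0) / t @[t --> (0 : R)^'] --> d.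
Proof.
move=> [df dv]; move: df; rewrite /derivable => /cvg_ex[l hl].
have := cvg_lim (@norm_hausdorff _ _) hl; rewrite -dv /derive => ->.
apply: cvg_trans hl; apply: near_eq_cvg; near=> t.
by rewrite /GRing.scale /= mulr1 addr0 mulrC.
Unshelve. all: by end_near.
Qed.

Lemma cexp_dnbhs0 (R : realType) (z : R[i]) :
  ((cexp (z * t%:C) - 1) / t%:C : R[i]^o) @[t --> (0 : R)^'] --> (z : R[i]^o).
Proof.
case: z => u v.
pose f (t : R) := expR (u * t) * cos (v * t).
pose g (t : R) := expR (u * t) * sin (v * t).
have de : is_derive (0 : R) 1 (fun t => expR (u * t)) (expR (u * 0) * u).
  exact: (is_derive1_comp (is_derive_expR _) (is_derive_scale _ _)).
have dc : is_derive (0 : R) 1 (fun t => cos (v * t)) (- sin (v * 0) * v).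
  exact: (is_derive1_comp (is_derive_cos _) (is_derive_scale _ _)).
have ds : is_derive (0 : R) 1 (fun t => sin (v * t)) (cos (v * 0) * v).
  exact: (is_derive1_comp (is_derive_sin _) (is_derive_scale _ _)).
have df : is_derive (0:R) 1 f u.
  apply: is_derive_eq (is_deriveM de dc) _.
  by rewrite /GRing.scale /= !mulr0 expR0 cos0 sin0; ring.
have dg : is_derive (0:R) 1 g v.
  apply: is_derive_eq (is_deriveM de ds) _.
  by rewrite /GRing.scale /= !mulr0 expR0 cos0 sin0; ring.
have -> : u +i* v = u%:C + 'i%C * v%:C by simpc.
have -> : (fun t : R => (cexp ((u%:C + 'i%C * v%:C) * t%:C) - 1) / t%:C)
  = (fun t : R => ((f t - f 0) / t)%:C + 'i%C * ((g t - g 0) / t)%:C).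
  apply/funext => t; rewrite /f /g !mulr0 expR0 cos0 sin0.
  have -> : (u%:C + 'i%C * v%:C) * t%:C = (u * t) +i* (v * t) by simpc.
  rewrite /cexp /= !rmorphM !fmorphV /= mulrA -mulrDl; congr (_ / _).
  by simpc.
apply: cvg_complexD; first exact: (cvg_real_complex (is_derive0_quotient df)).
by apply: cvg_complexM; [exact: cvg_cst | exact: (cvg_real_complex (is_derive0_quotient dg))].
Qed.


Lemma ln_cvg1 (R : realType) : ln s @[s --> (1 : R)] --> (0 : R).
Proof. by rewrite -[X in _ --> X](@ln1 R); exact: continuous_ln. Qed.

(** Near 1 from the left ln s is nonzero, so that ln s tends to 0 in the punctured
    sense required to substitute it into a difference quotient at 0. *)
Lemma ln_at_left1 (R : realType) : ln s @[s --> (1 : R)^'-] --> (0 : R)^'.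
Proof.
move=> A hA.
have h : nbhs (1 : R) (fun s : R => ln s != 0 -> A (ln s)) := @ln_cvg1 R _ hA.
rewrite /nbhs /=; near=> s.
have s1 : s < 1 by near: s; exact: nbhs_left_lt.
have s0 : 0 < s by near: s; exact: nbhs_left_gt.
suff /(_ _) : ln s != 0 -> A (ln s) by apply; rewrite ln_eq0 // lt_eqF.
by near: s; rewrite /at_left near_withinE; apply: filterS h => y hy _; exact: hy.
Unshelve. all: by end_near.
Qed.

(** As s ^ z = exp (z ln s), this is the derivative of the exponential at 0 in the
    variable ln s. *)
Lemma cpow_slope (R : realType) (z : R[i]) :
  ((cpow s z - 1) / (ln s)%:C : R[i]^o) @[s --> (1 : R)^'-] --> (z : R[i]^o).
Proof.
apply: (@cvg_comp _ _ _ (@ln R) (fun t : R => (cexp (z * t%:C) - 1) / t%:C : R[i]^o)).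
  exact: ln_at_left1.
exact: cexp_dnbhs0.
Qed.

Lemma cpow_at_left1 (R : realType) (z : R[i]) :
  (cpow s z : R[i]^o) @[s --> (1 : R)^'-] --> (1 : R[i]^o).
Proof.
have hln : ((ln s)%:C : R[i]^o) @[s --> (1 : R)^'-] --> (0 : R[i]^o).
  have h : ln s @[s --> (1 : R)^'-] --> (0 : R).
    exact: cvg_within_filter (@ln_cvg1 R).
  exact: (cvg_real_complex h).
have h : ((cpow s z - 1) / (ln s)%:C * (ln s)%:C + 1 : R[i]^o)
    @[s --> (1 : R)^'-] --> (z * 0 + 1 : R[i]^o).
  apply: cvg_complexD; last exact: cvg_cst.
  by apply: cvg_complexM hln; exact: cpow_slope.
rewrite mulr0 add0r in h; apply: cvg_trans h; apply: near_eq_cvg.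
near=> s.
have s1 : s < 1 by near: s; exact: nbhs_left_lt.
have s0 : 0 < s by near: s; exact: nbhs_left_gt.
rewrite mulfVK ?subrK //.
by rewrite (fmorph_eq0 (real_complex R)) ln_eq0 // lt_eqF.
Unshelve. all: by end_near.
Qed.

(** Dividing numerator and denominator by ln s reduces the indeterminate form 0 / 0
    to two slopes. *)
Lemma cpow_ratio (R : realType) (a b : R[i]) : b != 0 ->
  ((1 - cpow s a) / (1 - cpow s b) : R[i]^o) @[s --> (1 : R)^'-] --> (a / b : R[i]^o).
Proof.
move=> b0.
have h : ((cpow s a - 1) / (ln s)%:C * ((cpow s b - 1) / (ln s)%:C)^-1 : R[i]^o)
    @[s --> (1 : R)^'-] --> (a / b : R[i]^o).
  by apply: cvg_complexM; [|apply: cvg_complexV => //]; exact: cpow_slope.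
apply: cvg_trans h; apply: near_eq_cvg.
near=> s.
have s1 : s < 1 by near: s; exact: nbhs_left_lt.
have s0 : 0 < s by near: s; exact: nbhs_left_gt.
have l0 : (ln s)%:C%C != 0.
  by rewrite (fmorph_eq0 (real_complex R)) ln_eq0 // lt_eqF.
rewrite invf_div mulrA mulfVK //.
by rewrite -[cpow s a - 1]opprB -[cpow s b - 1]opprB invrN mulrNN.
Unshelve. all: by end_near.
Qed.

Lemma cpowD (R : realType) (s : R) (z w : R[i]) : cpow s (z + w) = cpow s z * cpow s w.
Proof. by rewrite /cpow mulrDl cexpD. Qed.

Lemma cpow_nat (R : realType) (s : R) (n : nat) : 0 < s -> cpow s n%:R = s%:C ^+ n.
Proof.
move=> s0; elim: n => [|n IH].
  by rewrite /cpow mul0r /cexp /= expR0 cos0 sin0 mul1r.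
rewrite -natr1 cpowD IH exprSr; congr (_ * _).
by rewrite /cpow mul1r /cexp /= lnK ?posrE // cos0 sin0 mulr1.
Qed.

Lemma omega_exp (R : realType) (k m : nat) :
  omega R k ^+ m = cexp (0 +i* (m%:R * (2 * pi / k%:R))).
Proof.
elim: m => [|m IH].
  by rewrite mul0r /cexp /= expR0 cos0 sin0 mul1r.
rewrite exprSr IH /omega -cexpD; congr cexp; simpc.
by congr (_ +i* _); rewrite -natr1; ring.
Qed.

(** If 0 < i < k then the half-angle pi i / k lies strictly between 0 and pi, where
    the sine is positive; this excludes cos (2 pi i / k) = 1. *)
Lemma omega_primitive (R : realType) (k : nat) : (0 < k)%N ->
  k.-primitive_root (omega R k).
Proof.
move=> k0; have kR : (k%:R : R) != 0 by rewrite pnatr_eq0 -lt0n.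
rewrite /primitive_root_of_unity k0 /=; apply/forallP => -[i ik] /=.
apply/eqP; rewrite unity_rootE omega_exp.
have [->|ne] := eqVneq i.+1 k.
  have -> : k%:R * (2 * pi / k%:R) = pi *+ 2 :> R.
    by rewrite mulr2n; field.
  by rewrite /cexp /= expR0 cos2pi sin2pi mul1r eqxx.
apply/negbTE/eqP; set a : R := pi * (i.+1)%:R / k%:R.
have -> : i.+1%:R * (2 * pi / k%:R) = a *+ 2 :> R.
  by rewrite /a mulr2n; ring.
rewrite /cexp /= expR0 mul1r => -[h _].
have : 0 < sin a.
  apply: sin_gt0_pi; rewrite /a !mulr_gt0 ?pi_gt0 ?invr_gt0 ?ltr0n //=.
  rewrite ltr_pdivrMr ?ltr0n // ltr_pM2l ?pi_gt0 // ltr_nat.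
  by rewrite ltn_neqAle ne.
have := cos2Dsin2 a; move: h; rewrite cos_mulr2n.
move: (sin a) (cos a) => u v h1 h2 h3; have : u ^+ 2 = 0 by lra.
by move/eqP; rewrite sqrf_eq0 gt_eqF.
Qed.

(** * The limiting recurrence *)

Lemma cvg_eq_at_left1 (R : realType) (f g : R -> R[i]) (l : R[i]) :
  (forall s, 0 < s < 1 -> f s = g s) ->
  (f s : R[i]^o) @[s --> (1 : R)^'-] --> (l : R[i]^o) ->
  (g s : R[i]^o) @[s --> (1 : R)^'-] --> (l : R[i]^o).
Proof.
move=> fg; apply: cvg_trans; apply: near_eq_cvg; near=> s.
apply/fg/andP; split; near: s; [exact: nbhs_left_gt|exact: nbhs_left_lt].
Unshelve. all: by end_near.
Qed.

(** The limit of (1 - s ^ (a k) q ^ m) / (1 - s ^ (b k) q ^ m) for q = s omega_k and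
    s tending to 1: only the indices divisible by k are affected. *)
Definition sieve (F : fieldType) (k m : nat) (a b : F) : F :=
  if (k %| m)%N then (a + (m %/ k)%:R) / (b + (m %/ k)%:R) else 1.

(** When k divides m the root of unity disappears from q ^ m and a ratio of powers of
    s remains; otherwise numerator and denominator have the same nonzero limit
    1 - omega_k ^ m. *)
Lemma ultrac_coef_cvg (R : realType) (a b : R[i]) (k m : nat) : (0 < k)%N ->
  ~~ (k %| m)%N || (b + (m %/ k)%:R != 0) ->
  ((1 - cpow s (a * k%:R) * (s%:C * omega R k) ^+ m)
    / (1 - cpow s (b * k%:R) * (s%:C * omega R k) ^+ m) : R[i]^o)
    @[s --> (1 : R)^'-] -->
  (sieve k m a b : R[i]^o).
Proof.
move=> k0 hb; have kC : (k%:R : R[i]) != 0 by rewrite pnatr_eq0 -lt0n.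
have om := omega_primitive R k0; rewrite /sieve; case: ifPn hb => /= km hb.
  have e : omega R k ^+ m = 1 by apply/eqP; rewrite -(prim_order_dvd om).
  set r := (m %/ k)%N in hb *; have mE : (m = r * k)%N by rewrite /r divnK.
  have -> : (a + r%:R) / (b + r%:R) = ((a + r%:R) * k%:R) / ((b + r%:R) * k%:R).
    by field; rewrite kC hb.
  apply: (@cvg_eq_at_left1 _ (fun s =>
    (1 - cpow s ((a + r%:R) * k%:R)) / (1 - cpow s ((b + r%:R) * k%:R)))); last first.
    exact: (@cpow_ratio R ((a + r%:R) * k%:R) _ (mulf_neq0 hb kC)).
  move=> s /andP[s0 _].
  have E c : cpow s ((c + r%:R) * k%:R) = cpow s (c * k%:R) * (s%:C * omega R k) ^+ m.
    by rewrite mulrDl -natrM -mE cpowD cpow_nat // (exprMn _ s%:C) e mulr1.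
  by rewrite !E.
have w1 : 1 - omega R k ^+ m != 0.
  by rewrite subr_eq0 eq_sym -(prim_order_dvd om).
have h c : (1 - cpow s (c * k%:R) * (s%:C * omega R k) ^+ m : R[i]^o)
    @[s --> (1 : R)^'-] --> (1 - omega R k ^+ m : R[i]^o).
  apply: (@cvg_eq_at_left1 _
    (fun s => 1 + (-1) * (cpow s (c * k%:R + m%:R) * omega R k ^+ m))).
    move=> s /andP[s0 _].
    by rewrite cpowD (@cpow_nat R s m) // (exprMn _ s%:C); ring.
  have -> : 1 - omega R k ^+ m = 1 + (-1) * (1 * omega R k ^+ m).
    by rewrite mul1r mulN1r.
  apply: cvg_complexD; first exact: cvg_cst.
  apply: cvg_complexM; first exact: cvg_cst.
  by apply: cvg_complexM; [exact: cpow_at_left1 | exact: cvg_cst].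
rewrite -[X in _ --> X](divff w1).
by apply: cvg_complexM; [|apply: cvg_complexV => //]; exact: h.
Qed.

(** The recurrence passes to the limit because each of its coefficients converges;
    convergence of the polynomials themselves is obtained along the same induction. *)
Lemma sieved_c_rec (R : realType) (k : nat) (lam x : R[i]) : (1 < k)%N ->
  (forall m : nat, (0 < m)%N -> 2 * lam + m%:R != 0) ->
  [/\ sieved_c lam k 0 x = 1, sieved_c lam k 1 x = x
    & forall m, sieved_c lam k m.+2 x =
        2 * sieve k m.+1 lam (2 * lam) * x * sieved_c lam k m.+1 x
        - sieve k m.+1 0 (2 * lam) * sieved_c lam k m x].
Proof.
move=> k1 hlam; have k0 : (0 < k)%N by apply: ltnW.
pose u n (s : R) := (ultrac (cpow s (lam * k%:R)) (s%:C * omega R k) n).[x].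
(* The limits are abstracted as a sequence c, to be handled only through ulim. *)
have [c cE ulim] : exists2 c : nat -> R[i], (forall n, sieved_c lam k n x = c n)
    & forall n l, (u n s : R[i]^o) @[s --> (1 : R)^'-] --> (l : R[i]^o) -> c n = l.
  exists (fun n => sieved_c lam k n x) => // n l h.
  by apply: cvg_lim h; exact: norm_hausdorff.
have h0 : (u 0 s : R[i]^o) @[s --> (1 : R)^'-] --> (1 : R[i]^o).
  by rewrite /u /=; under eq_fun do rewrite hornerC; exact: cvg_cst.
(* The coefficient of c_1 is 2 / (1 + beta), and beta tends to 1. *)
have h1 : (u 1 s : R[i]^o) @[s --> (1 : R)^'-] --> (x : R[i]^o).
  have -> : x = 2 * (1 + 1)^-1 * x by field.
  rewrite /u /=; under eq_fun do rewrite hornerZ hornerX.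
  apply: cvg_complexM; last exact: cvg_cst.
  apply: cvg_complexM; first exact: cvg_cst.
  apply: cvg_complexV; first by rewrite (_ : 1 + 1 = 2) // pnatr_eq0.
  by apply: cvg_complexD; [exact: cvg_cst|exact: cpow_at_left1].
have hS m lm lm1 : (u m s : R[i]^o) @[s --> (1 : R)^'-] --> (lm : R[i]^o) ->
    (u m.+1 s : R[i]^o) @[s --> (1 : R)^'-] --> (lm1 : R[i]^o) ->
    (u m.+2 s : R[i]^o) @[s --> (1 : R)^'-] -->
      (2 * sieve k m.+1 lam (2 * lam) * x * lm1 - sieve k m.+1 0 (2 * lam) * lm : R[i]^o).
  move=> cm cm1.
  have hb : ~~ (k %| m.+1)%N || (2 * lam + (m.+1 %/ k)%:R != 0).
    case: (boolP (k %| m.+1)%N) => //= km; apply: hlam.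
    by rewrite divn_gt0 // dvdn_leq.
  have ca := @ultrac_coef_cvg R lam (2 * lam) k m.+1 k0 hb.
  have cb := @ultrac_coef_cvg R 0 (2 * lam) k m.+1 k0 hb.
  rewrite -mulN1r.
  apply: cvg_eq_at_left1; last first.
    apply: cvg_complexD; last first.
      by apply: cvg_complexM; [exact: cvg_cst|apply: cvg_complexM cb cm].
    apply: cvg_complexM cm1; apply: cvg_complexM; last exact: cvg_cst.
    by apply: cvg_complexM ca; exact: cvg_cst.
  move=> s /andP[s0 _]; rewrite {3}/u.
  set q := s%:C * _; set be := cpow s (lam * _).
  have -> : ultrac be q m.+2 = (1 - be ^+ 2 * q ^+ m.+1)^-1 *:
     ((2 * (1 - be * q ^+ m.+1)) *: ('X * ultrac be q m.+1)
       - (1 - q ^+ m.+1) *: ultrac be q m) by [].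
  rewrite hornerZ hornerD hornerN !hornerZ hornerM hornerX -/(u m.+1 s) -/(u m s).
  have -> : cpow s (2 * lam * k%:R) = be ^+ 2.
    by rewrite expr2 -cpowD; congr cpow; ring.
  rewrite mul0r (@cpow_nat R s 0) // expr0 mul1r; ring.
clearbody u; have all m : (u m s : R[i]^o) @[s --> (1 : R)^'-] --> (c m : R[i]^o)
   /\ (u m.+1 s : R[i]^o) @[s --> (1 : R)^'-] --> (c m.+1 : R[i]^o).
  elim: m => [|m [IH0 IH1]].
    have e0 := ulim 0 1 h0; have e1 := ulim 1 x h1.
    by split; [rewrite e0; exact: h0 | rewrite e1; exact: h1].
  by have h := hS m _ _ IH0 IH1; rewrite (ulim m.+2 _ h).
rewrite !cE; split; [exact: ulim h0|exact: ulim h1|move=> m; rewrite !cE].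
by have [c0 c1] := all m; exact: (ulim m.+2 _ (hS m _ _ c0 c1)).
Qed.

(** * Chebyshev polynomials *)

Lemma poly_pointwise (F : numFieldType) (p q : {poly F}) :
  (forall x, p.[x] = q.[x]) -> p = q.
Proof.
move=> h; apply/eqP; rewrite -subr_eq0; apply/eqP.
apply: (@roots_geq_poly_eq0 _ _ [seq i%:R | i <- iota 0 (size (p - q)).+1]).
- by apply/allP => _ /mapP[i _ ->]; rewrite rootE hornerD hornerN h subrr.
- by rewrite map_inj_uniq ?iota_uniq // => a b /eqP; rewrite eqr_nat => /eqP.
- by rewrite size_map size_iota.
Qed.

(** Monic Chebyshev polynomials of the second kind, indexed by degree plus one: with
    this shift the sequence starts at 0, 1 and satisfies its three-term recurrence
    from the start, free of the special values of [Uhat] at negative indices. *)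
HB.lock
Definition monU (F : fieldType) (m : nat) : {poly F} := Uhat F (m%:Z - 1).

Section ChebyshevIdentities.
Variable F : numFieldType.
Implicit Types (x lam : F) (j l k n m : nat).

Notation V := (monU F).

Lemma monUS m : V m.+1 = 2 ^- m *: chebU F m.
Proof. by rewrite monU.unlock -addn1 PoszD addrK. Qed.

Lemma monU0 : V 0 = 0. Proof. by rewrite monU.unlock. Qed.

Lemma monU1 : V 1 = 1. Proof. by rewrite monUS expr0 invr1 scale1r. Qed.

Lemma monUSS m x : (V m.+2).[x] = x * (V m.+1).[x] - (V m).[x] / 4.
Proof.
case: m => [|m]; first by rewrite monU0 monU1 monUS /= !hornerZ hornerX horner0 hornerC; field.
rewrite !monUS.
have -> : chebU F m.+2 = 2 *: ('X * chebU F m.+1) - chebU F m by [].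
rewrite !hornerZ hornerD hornerN hornerZ hornerM hornerX !exprS.
have : (2 : F) ^+ m != 0 by rewrite expf_neq0 // pnatr_eq0.
by move: (2 ^+ m) => c c0; field.
Qed.

(** Both sides satisfy the recurrence of V in j; this is the identity
    U_(j+l) = U_j U_l - U_(j-1) U_(l-1) for monic polynomials. *)
Lemma monU_addS j l x : 
  (V (j + l).+1).[x] = (V j.+1).[x] * (V l.+1).[x] - (V j).[x] * (V l).[x] / 4.
Proof.
suff: (V (j + l).+1).[x] = (V j.+1).[x] * (V l.+1).[x] - (V j).[x] * (V l).[x] / 4
 /\ (V (j + l).+2).[x] = (V j.+2).[x] * (V l.+1).[x] - (V j.+1).[x] * (V l).[x] / 4.
  by case.
elim: j => [|j [IH0 IH1]].
  by rewrite add0n !monUSS monU0 monU1 hornerC horner0; split; field.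
by rewrite addSn; split=> //; rewrite monUSS IH0 IH1 !monUSS; field.
Qed.

Lemma monU_add j l x : 
  (V (j + l)).[x] = (V j).[x] * (V l.+1).[x] + (V j.+1).[x] * (V l).[x]
    - x * (V j).[x] * (V l).[x].
Proof.
case: j => [|j]; first by rewrite add0n monU0 monU1 horner0 hornerC; ring.
by rewrite addSn monU_addS monUSS; ring.
Qed.

Lemma That_monU k x : (0 < k)%N ->
  (That F k).[x] = x * (V k).[x] - (V k.-1).[x] / 2.
Proof.
case: k => // k _.
suff: (That F k.+1).[x] = x * (V k.+1).[x] - (V k).[x] / 2
 /\ (That F k.+2).[x] = x * (V k.+2).[x] - (V k.+1).[x] / 2 by case.
elim: k => [|k [IH0 IH1]].
  rewrite /That monUSS monU0 monU1 /= !hornerZ hornerD hornerN hornerZ hornerM !hornerX !hornerC.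
  by split; field.
split=> //.
have -> : (That F k.+3).[x] = x * (That F k.+2).[x] - (That F k.+1).[x] / 4.
  rewrite /That.
  have -> : chebT F k.+3 = 2 *: ('X * chebT F k.+2) - chebT F k.+1 by [].
  rewrite !hornerZ hornerD hornerN hornerZ hornerM hornerX !exprS.
  have : (2 : F) ^+ k != 0 by rewrite expf_neq0 // pnatr_eq0.
  by move: (2 ^+ k) => c c0; field.
by rewrite IH0 IH1 !monUSS; ring.
Qed.

(** The classical (1 - x^2) U_(m-1)' = x U_(m-1) - m T_m, in monic form and with T_m
    expressed through U. *)
Lemma deriv_monU m x :
  (1 - x ^+ 2) * (V m)^`().[x]
    = (1 - m%:R) * x * (V m).[x] + m%:R * ((V m.-1).[x] / 2).
Proof.
suff: (1 - x ^+ 2) * (V m)^`().[x]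
    = (1 - m%:R) * x * (V m).[x] + m%:R * ((V m.-1).[x] / 2)
  /\ (1 - x ^+ 2) * (V m.+1)^`().[x]
    = (1 - m.+1%:R) * x * (V m.+1).[x] + m.+1%:R * ((V m).[x] / 2) by case.
elim: m => [|m [IH0 IH1]].
  by rewrite monU0 monU1 -(polyC1 F) !derivC horner0 hornerC; split; ring.
split=> //.
have -> : V m.+2 = 'X * V m.+1 - 4^-1 *: V m.
  apply: poly_pointwise => y.
  by rewrite monUSS hornerD hornerN hornerZ hornerM hornerX; ring.
rewrite derivB derivM derivX derivZ mul1r.
rewrite !hornerD !hornerN !hornerZ !hornerM !hornerX.
rewrite !mulrDr mulrN [_ * (x * _)]mulrCA IH1 [_ * (4^-1 * _)]mulrCA IH0.
case: m {IH0 IH1} => [|m]; first by rewrite monU0 monU1 horner0 hornerC; field.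
by rewrite !monUSS; field.
Qed.

End ChebyshevIdentities.

(** * From first order structure relations to a second order equation *)

(** Differentiate the first relation, multiply by Phi M, and remove q and q' using
    the two relations.  The coefficient of p then contains the left-hand side of the
    last hypothesis, so that a factor Phi can be cancelled. *)
Lemma ode_of_structure (F : fieldType) (Phi Psi M M1 N Om p q : {poly F}) (g : F) :
  Phi != 0 ->
  Phi * p^`() = N * p + M * q ->
  Phi * q^`() = (Phi^`() - Psi - N) * q - g *: (M1 * p) ->
  (Phi^`() - Psi - N) * N + g *: (M1 * M) = Phi * Om ->
  Phi * M * p^`(2) + (Psi * M - Phi * M^`()) * p^`()
    + (N * M^`() + (Om - N^`()) * M) * p = 0.
Proof.
move=> Phi0 h1 h2 h3; apply: (mulfI Phi0); rewrite mulr0.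
have h0 : Phi^`() * p^`() + Phi * p^`(2)
    = N^`() * p + N * p^`() + (M^`() * q + M * q^`()).
  by have := congr1 (@deriv F) h1; rewrite derivD !derivM.
move/eqP: h0; rewrite -subr_eq0 => /eqP h0.
move/eqP: h1; rewrite -subr_eq0 => /eqP h1.
move/eqP: h2; rewrite -subr_eq0 => /eqP h2.
move/eqP: h3; rewrite -subr_eq0 => /eqP h3.
rewrite -!mul_polyC in h2 h3.
(* The multipliers of the derivative of the first relation, of the two relations
   and of the last hypothesis in the elimination. *)
transitivity (M * Phi * 0 - (M^`() * Phi + (Phi^`() - Psi - N) * M) * 0
  + M ^+ 2 * 0 - M * p * 0); last by rewrite !mulr0 !subr0 addr0.
rewrite -{1}h0 -{1}h1 -{1}h2 -h3; ring.
Qed.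

(** * The coefficient polynomials *)

Section Coefficients.
Variables (F : numFieldType) (lam : F) (k : nat).
Hypothesis k1 : (1 < k)%N.
Implicit Types (x : F) (j l n m : nat).
Local Notation V := (monU F).
Local Notation L := (lam * k%:R).

Lemma Uhat_monU m : Uhat F (m%:Z - 1) = V m.
Proof. by rewrite monU.unlock. Qed.

(** At m = 0 the value of [Uhat] at -2 is 0, not the -4 which continuing the
    recurrence of V downwards would give.  This explains the separate form of M at
    j = 0 and, for N, the correction epsilon at j = 0 and j = k - 1. *)
Lemma Uhat_monU_pred m : Uhat F (m%:Z - 2) = V m.-1.
Proof.
case: m => [|m] /=; first by rewrite monU0.
by rewrite -Uhat_monU; congr Uhat; lia.
Qed.

Lemma horner_MP0 n x :
  (MP lam k n 0).[x] = - (2 * (n%:R + lam) * k%:R) * (V k).[x].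
Proof.
rewrite /MP !Uhat_monU_pred !Uhat_monU /= monU0 !mul0r subrr scaler0 subr0.
by rewrite hornerZ natrD natrM; ring.
Qed.

Lemma horner_MP n j l x : k = (j.+1 + l).+1 ->
  (MP lam k n j.+1).[x] =
    - 2 * ((n * k + j.+1)%:R + 2 * L) * (V k).[x]
    - L * (V j.+1).[x] * (V l).[x] + 2 * L * x * (V j.+1).[x] * (V l.+1).[x].
Proof.
move=> kE; rewrite /MP.
have -> : k%:Z - j.+1%:Z - 2 = l%:Z - 1 by lia.
have -> : k%:Z - j.+1%:Z - 1 = l.+1%:Z - 1 by lia.
rewrite !Uhat_monU_pred !Uhat_monU /= hornerD hornerN !hornerZ.
rewrite !hornerD !hornerN !hornerM.
have -> : (V k).[x] = (V j.+2).[x] * (V l.+1).[x] - (V j.+1).[x] * (V l).[x] / 4.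
  by rewrite kE monU_addS.
by rewrite !monUSS; field.
Qed.

(** The term with epsilon compensates the vanishing of [Uhat] at index -2, which
    occurs at both ends j = 0 and l = 0; the resulting closed form is uniform in j. *)
Lemma horner_NP n j l x : k = (j + l).+1 ->
  (NP lam k n j).[x] =
    ((n * k + j)%:R + 2 * L) * x * (V k).[x]
    - L * (V j).[x] * (V l.+1).[x] + L / 2 * x * (V j).[x] * (V l).[x].
Proof.
move=> kE; rewrite /NP.
have -> : k%:Z - j%:Z - 2 = l%:Z - 1 by lia.
have -> : k%:Z - j%:Z - 3 = l%:Z - 2 by lia.
rewrite !Uhat_monU_pred !Uhat_monU.
rewrite !hornerD !hornerN !hornerZ !hornerM hornerD hornerN !hornerM hornerX.
have -> : (V k.-1).[x] = (V j).[x] * (V l.+1).[x] + (V j.+1).[x] * (V l).[x]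
    - x * (V j).[x] * (V l).[x] by rewrite kE /= monU_add.
rewrite /eps kE /=.
case: j l kE => [|j] [|l] kE; first by move: k1; rewrite kE.
(* j = 0, where epsilon is 0 *)
- by rewrite !monU0 horner0 /=; ring.
(* j = k - 1, where epsilon is 1 *)
- by rewrite addn0 eqxx monU0 monU1 horner0 hornerC /=; ring.
- have -> : (j.+1 == j.+1 + l.+1)%N = false by rewrite -{1}[j.+1]addn0 eqn_add2l.
  by rewrite /= !monUSS; field.
Qed.

Lemma horner_OmegaP n j l x : k = (j + l).+1 ->
  (OmegaP lam k n j).[x] =
    (n * k + j + 1)%:R * ((n * k + j)%:R + 2 * L) * (V k).[x]
    + L / 2 * (V j).[x] * (V l).[x].
Proof.
move=> kE; rewrite /OmegaP.
have -> : k%:Z - j%:Z - 2 = l%:Z - 1 by lia.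
by rewrite !Uhat_monU hornerD !hornerZ hornerM; ring.
Qed.

Lemma horner_PhiP x : (PhiP F k).[x] = (1 - x ^+ 2) * (V k).[x].
Proof.
by rewrite /PhiP Uhat_monU hornerM hornerD hornerN hornerXn hornerC.
Qed.

(** The trace of the first order system formed by the structure relations. *)
Definition Gpoly := (PhiP F k)^`() - PsiP lam k.

Lemma horner_Gpoly x :
  Gpoly.[x] = (2 * L - 1) * x * (V k).[x] - L * (V k.-1).[x].
Proof.
rewrite /Gpoly /PhiP /PsiP Uhat_monU derivM derivB derivXn -(polyC1 F) derivC.
rewrite hornerD hornerN hornerD !hornerM hornerD hornerN hornerMn.
rewrite hornerX hornerZ polyC1 hornerC !hornerD hornerN hornerXn !hornerC.
by rewrite deriv_monU That_monU ?(ltnW k1) //; field.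
Qed.

Hypothesis hlam : forall m, (0 < m)%N -> m%:R + lam != 0.

(** The coefficients of the monic recurrence.  The value at 1 is set apart, since the
    quotient (m + 2 lam) / (4 (m + lam)) degenerates at m = 0 when lam = 0. *)
Definition gam (N : nat) : F :=
  let m := (N %/ k)%:R in
  if N == 1 then 1 / 2
  else if (k %| N)%N then m / (4 * (m + lam))
  else if (k %| N.-1)%N then (m + 2 * lam) / (4 * (m + lam))
  else 1 / 4.

Lemma gam_mul n : (0 < n)%N -> gam (n * k) = n%:R / (4 * (n%:R + lam)).
Proof.
move=> n0; rewrite /gam dvdn_mull // mulnK ?(ltnW k1) //.
by rewrite muln_eq1 (gtn_eqF k1) andbF.
Qed.

Lemma gam_mulS n :
  gam (n * k).+1 = if n == 0 then 1 / 2 else (n%:R + 2 * lam) / (4 * (n%:R + lam)).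
Proof.
have k0 := ltnW k1; rewrite /gam eqSS muln_eq0 (gtn_eqF k0) orbF /= dvdn_mull //.
have -> : (k %| (n * k).+1)%N = false.
  by rewrite -addn1 dvdn_addr ?dvdn_mull // dvdn1 (gtn_eqF k1).
suff -> : ((n * k).+1 %/ k = n)%N by [].
by rewrite -addn1 divnMDl // (divn_small k1) addn0.
Qed.

Lemma gam_other n j : (1 < j < k)%N -> gam (n * k + j) = 1 / 4.
Proof.
case: j => [|[|j]] // /andP[_ jk]; rewrite /gam.
have -> : (n * k + j.+2 == 1)%N = false by lia.
rewrite !addnS /= -!addnS !dvdn_addr ?dvdn_mull //.
by rewrite !gtnNdvd // ltnW.
Qed.

(** This product has the shape that M has at other indices, divided by 4: the value
    of gamma just after a multiple of k corrects the irregular M at j = 0. *)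
Lemma gam_MP0 n x :
  gam (n * k).+1 * (MP lam k n 0).[x] = - ((n%:R + 2 * lam) * k%:R / 2) * (V k).[x].
Proof.
rewrite gam_mulS horner_MP0; case: eqP => [->|/eqP n0]; first by field.
by field; rewrite hlam // lt0n.
Qed.

Fact horner_XMDD (p q r : {poly F}) x :
  ('X * p + q + r).[x] = x * p.[x] + q.[x] + r.[x].
Proof. by rewrite !hornerD hornerM hornerX. Qed.

(** Inside a block both indices satisfy j + 1 + l = k with j increasing and l
    decreasing by one; the wrap-around from j = k - 1 to the next block is separate. *)
Lemma MP_NP_step n j : (j.+1 < k)%N ->
  'X * MP lam k n j.+1 + NP lam k n j + NP lam k n j.+1 = Gpoly.
Proof.
move=> jk; have [l kE] : {l | k = (j.+1 + l).+1} by exists (k - j.+2)%N; lia.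
apply: poly_pointwise => x; rewrite horner_XMDD horner_Gpoly.
rewrite (horner_MP n x kE) (horner_NP n x kE) (@horner_NP n j l.+1); last by lia.
have -> : (V k).[x] = (V j.+2).[x] * (V l.+1).[x] - (V j.+1).[x] * (V l).[x] / 4.
  by rewrite kE monU_addS.
have -> : (V k.-1).[x] = (V j.+1).[x] * (V l.+1).[x] + (V j.+2).[x] * (V l).[x]
    - x * (V j.+1).[x] * (V l).[x] by rewrite kE monU_add.
by rewrite !monUSS; field.
Qed.

Lemma MP_NP_wrap n :
  'X * MP lam k n.+1 0 + NP lam k n k.-1 + NP lam k n.+1 0 = Gpoly.
Proof.
have kE : k = k.-1.+1 by rewrite prednK // ltnW.
apply: poly_pointwise => x; rewrite horner_XMDD horner_Gpoly.
rewrite horner_MP0 (@horner_NP n.+1 0 k.-1) // (@horner_NP n k.-1 0) ?addn0 //.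
rewrite -kE monU0 monU1 horner0 hornerC.
have -> : (n * k + k.-1)%:R = n.+1%:R * k%:R - 1 :> F.
  have e : k%:R = k.-1%:R + 1 :> F by rewrite natr1 -kE.
  by rewrite natrD natrM -[n.+1%:R]natr1 e; ring.
by rewrite natrM; ring.
Qed.

Lemma OmegaP_step n j : (j.+1 < k)%N ->
  OmegaP lam k n j.+1 = OmegaP lam k n j - MP lam k n j.+1.
Proof.
move=> jk; have [l kE] : {l | k = (j.+1 + l).+1} by exists (k - j.+2)%N; lia.
apply: poly_pointwise => x; rewrite (hornerD (OmegaP lam k n j)) hornerN.
rewrite (horner_MP n x kE) (horner_OmegaP n x kE) (@horner_OmegaP n j l.+1); last by lia.
have -> : (V k).[x] = (V j.+2).[x] * (V l.+1).[x] - (V j.+1).[x] * (V l).[x] / 4.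
  by rewrite kE monU_addS.
by rewrite !monUSS; field.
Qed.

Lemma OmegaP_wrap n :
  OmegaP lam k n.+1 0 = OmegaP lam k n k.-1 - MP lam k n.+1 0.
Proof.
have kE : k = k.-1.+1 by rewrite prednK // ltnW.
apply: poly_pointwise => x; rewrite (hornerD (OmegaP _ _ _ _)) hornerN horner_MP0.
rewrite (@horner_OmegaP n.+1 0 k.-1) // (@horner_OmegaP n k.-1 0) ?addn0 //.
rewrite monU0 horner0.
have -> : (n * k + k.-1)%:R = n.+1%:R * k%:R - 1 :> F.
  have e : k%:R = k.-1%:R + 1 :> F by rewrite natr1 -kE.
  by rewrite natrD natrM -[n.+1%:R]natr1 e; ring.
have -> : (n * k + k.-1 + 1)%:R = n.+1%:R * k%:R :> F.
  by rewrite -natrM; congr _%:R; lia.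
by rewrite !natrD natrM; ring.
Qed.

(** Uniform for 0 <= j <= k - 2, the case j = 0 included thanks to the value of gamma
    there. *)
Lemma gam_MP n j l x : k = (j + l).+2 ->
  gam (n * k + j).+1 * (MP lam k n j).[x] =
    (- 2 * ((n * k + j)%:R + 2 * L) * (V k).[x]
     - L * (V j).[x] * (V l.+1).[x] + 2 * L * x * (V j).[x] * (V l.+2).[x]) / 4.
Proof.
case: j => [|j] kE.
  by rewrite addn0 gam_MP0 monU0 horner0 natrM; field.
rewrite -addnS gam_other; last by rewrite /= kE; lia.
by rewrite (@horner_MP n j l.+1) ?addnS //; field.
Qed.

Lemma gam_MP_pred n j l x : k = (j.+2 + l).+1 ->
  gam (n * k + j.+2) * (MP lam k n j.+2).[x] =
    (- 2 * ((n * k + j.+2)%:R + 2 * L) * (V k).[x]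
     - L * (V j.+2).[x] * (V l).[x] + 2 * L * x * (V j.+2).[x] * (V l.+1).[x]) / 4.
Proof.
move=> kE; rewrite gam_other; last by rewrite /= kE; lia.
by rewrite (horner_MP n x kE); field.
Qed.

Lemma gam_MP0_pred n x : (0 < n)%N ->
  gam (n * k) * (MP lam k n 0).[x] = - (n%:R * k%:R / 2) * (V k).[x].
Proof. by move=> n0; rewrite gam_mul // horner_MP0; field; rewrite hlam. Qed.

Fact horner_PhiD (p q : {poly F}) x :
  (PhiP F k + 'X * (p - q)).[x] = (1 - x ^+ 2) * (V k).[x] + x * (p.[x] - q.[x]).
Proof. by rewrite hornerD horner_PhiP hornerM hornerX hornerD hornerN. Qed.

Fact hornerZB (a b : F) (p q : {poly F}) x :
  (a *: p - b *: q).[x] = a * p.[x] - b * q.[x].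
Proof. by rewrite hornerD hornerN !hornerZ. Qed.

Lemma PhiP_step n j : (j.+2 < k)%N ->
  PhiP F k + 'X * (NP lam k n j.+1 - NP lam k n j)
  = gam (n * k + j).+1 *: MP lam k n j - gam (n * k + j.+2) *: MP lam k n j.+2.
Proof.
move=> jk; have [l kE] : {l | k = (j.+2 + l).+1} by exists (k - j.+3)%N; lia.
apply: poly_pointwise => x; rewrite horner_PhiD hornerZB.
rewrite (gam_MP_pred n x kE) (@gam_MP n j l.+1); last by lia.
rewrite (@horner_NP n j.+1 l.+1) ?(@horner_NP n j l.+2); try lia.
have -> : (V k).[x] = (V j.+3).[x] * (V l.+1).[x] - (V j.+2).[x] * (V l).[x] / 4.
  by rewrite kE monU_addS.
by rewrite !monUSS; field.
Qed.

Lemma PhiP_step_last n j : j.+2 = k ->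
  PhiP F k + 'X * (NP lam k n j.+1 - NP lam k n j)
  = gam (n * k + j).+1 *: MP lam k n j - gam (n.+1 * k) *: MP lam k n.+1 0.
Proof.
move=> jk; apply: poly_pointwise => x; rewrite horner_PhiD hornerZB.
rewrite gam_MP0_pred // (@gam_MP n j 0) ?addn0 //.
rewrite (@horner_NP n j.+1 0) ?(@horner_NP n j 1); try lia.
have -> : (V k).[x] = (V j.+2).[x] by rewrite -jk.
have -> : k%:R = j%:R + 2 :> F by rewrite -jk -natrD addn2.
have -> : (n * k + j.+1)%:R = n.+1%:R * (j%:R + 2) - 1 :> F.
  by rewrite -jk; ring.
have -> : (n * k + j)%:R = n.+1%:R * (j%:R + 2) - 2 :> F.
  by rewrite -jk; ring.
by rewrite !monUSS monU1 monU0 horner0 hornerC; field.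
Qed.

(** Both products on the right involve the irregular values of gamma, whose sum is
    1/2; the denominators n + 1 + lam cancel in the difference. *)
Lemma PhiP_step_wrap n j : j.+2 = k ->
  PhiP F k + 'X * (NP lam k n.+1 0 - NP lam k n j.+1)
  = gam (n.+1 * k) *: MP lam k n j.+1 - gam (n.+1 * k).+1 *: MP lam k n.+1 1.
Proof.
move=> jk; apply: poly_pointwise => x; rewrite horner_PhiD hornerZB.
rewrite gam_mul // gam_mulS /= (@horner_MP n j 0) ?(@horner_MP n.+1 0 j); try lia.
rewrite (@horner_NP n j.+1 0) ?(@horner_NP n.+1 0 j.+1); try lia.
have -> : (V k).[x] = (V j.+2).[x] by rewrite -jk.
have -> : k%:R = j%:R + 2 :> F by rewrite -jk -natrD addn2.
have -> : (n * k + j.+1)%:R = n.+1%:R * (j%:R + 2) - 1 :> F.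
  by rewrite -jk; ring.
have -> : (n.+1 * k + 1)%:R = n.+1%:R * (j%:R + 2) + 1 :> F.
  by rewrite -jk; ring.
have -> : (n.+1 * k + 0)%:R = n.+1%:R * (j%:R + 2) :> F.
  by rewrite -jk; ring.
rewrite !monUSS monU1 monU0 horner0 hornerC.
have := hlam (ltn0Sn n); move: (n.+1%:R) => m hm.
by field; rewrite hm.
Qed.

(** * Relations indexed by the degree *)

Let MS N := MP lam k (N %/ k) (N %% k).
Let NS N := NP lam k (N %/ k) (N %% k).
Let OS N := OmegaP lam k (N %/ k) (N %% k).

Lemma divmod_cat n j : (j < k)%N -> ((n * k + j) %/ k = n)%N /\ ((n * k + j) %% k = j)%N.
Proof.
move=> jk; have k0 := ltnW k1.
by rewrite divnMDl // divn_small // addn0 modnMDl modn_small.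
Qed.

Lemma seqE (f : nat -> nat -> {poly F}) n j : (j < k)%N ->
  f ((n * k + j) %/ k)%N ((n * k + j) %% k)%N = f n j.
Proof. by move=> /(divmod_cat n)[-> ->]. Qed.

Lemma MS_NS N : 'X * MS N.+1 + NS N + NS N.+1 = Gpoly.
Proof.
rewrite /MS /NS (divn_eq N k); set n := (N %/ k)%N; set j := (N %% k)%N.
have jk : (j < k)%N by rewrite ltn_mod ltnW.
have [j1k|] := ltnP j.+1 k.
  by rewrite -addnS !seqE // MP_NP_step.
move=> kj; have -> : j = k.-1 by lia.
have -> : (n * k + k.-1).+1 = (n.+1 * k + 0)%N by lia.
by rewrite !seqE ?(ltnW k1) ?prednK ?MP_NP_wrap //; lia.
Qed.

Lemma OS_step N : OS N.+1 = OS N - MS N.+1.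
Proof.
rewrite /MS /OS (divn_eq N k); set n := (N %/ k)%N; set j := (N %% k)%N.
have jk : (j < k)%N by rewrite ltn_mod ltnW.
have [j1k|] := ltnP j.+1 k.
  by rewrite -addnS !seqE // OmegaP_step.
move=> kj; have -> : j = k.-1 by lia.
have -> : (n * k + k.-1).+1 = (n.+1 * k + 0)%N by lia.
by rewrite !seqE ?(ltnW k1) ?prednK ?OmegaP_wrap //; lia.
Qed.

Lemma PhiP_MS_NS N :
  PhiP F k + 'X * (NS N.+1 - NS N) = gam N.+1 *: MS N - gam N.+2 *: MS N.+2.
Proof.
rewrite /MS /NS (divn_eq N k); set n := (N %/ k)%N; set j := (N %% k)%N.
have jk : (j < k)%N by rewrite ltn_mod ltnW.
have [j2k|] := ltnP j.+2 k.
  by rewrite -!addnS !seqE ?(ltnW j2k) // PhiP_step // -addnS.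
rewrite leq_eqVlt => /orP[/eqP kj|kj].
  have e : (n * k + j).+2 = (n.+1 * k + 0)%N by lia.
  rewrite e -[(n * k + j).+1]addnS !seqE; try lia.
  by rewrite addn0 PhiP_step_last // addnS.
have [i iE] : {i | k = i.+2} by exists k.-2; lia.
have -> : j = i.+1 by lia.
have e : (n * k + i.+1).+1 = (n.+1 * k + 0)%N by lia.
have e2 : (n * k + i.+1).+2 = (n.+1 * k + 1)%N by lia.
rewrite e2 e !seqE; try lia.
by rewrite addn0 addn1 PhiP_step_wrap.
Qed.

(** * Structure relations and the differential equation *)

Variable p : nat -> {poly F}.
Hypotheses (p0 : p 0 = 1) (p1 : p 1 = 'X)
  (pS : forall N, p N.+2 = 'X * p N.+1 - gam N.+1 *: p N).

Lemma NS0 : NS 0 = - ('X * MS 0).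
Proof.
apply: poly_pointwise => x; rewrite hornerN hornerM hornerX.
rewrite /NS /MS div0n mod0n horner_MP0 (@horner_NP 0 0 k.-1) ?prednK ?(ltnW k1) //.
by rewrite monU0 horner0 /=; ring.
Qed.

Lemma OS0 : OS 0 = - MS 0.
Proof.
apply: poly_pointwise => x; rewrite hornerN.
rewrite /OS /MS div0n mod0n horner_MP0 (@horner_OmegaP 0 0 k.-1) ?prednK ?(ltnW k1) //.
by rewrite monU0 horner0 /=; ring.
Qed.

(** The second structure relation for the degrees 0 and 1. *)
Lemma PhiP0 : PhiP F k = (Gpoly - NS 0) * 'X - gam 1 *: MS 1.
Proof.
have [l kE] : {l | k = (1 + l).+1} by exists k.-2; lia.
have -> : Gpoly - NS 0 = 'X * MS 1 + NS 1 by rewrite -(MS_NS 0); ring.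
apply: poly_pointwise => x; rewrite horner_PhiP hornerD hornerM hornerD hornerM.
rewrite hornerN hornerZ !hornerX /gam eqxx /MS /NS modn_small // divn_small //.
rewrite (@horner_MP 0 0 l) // (@horner_NP 0 1 l) //.
have -> : (V k).[x] = (V 2).[x] * (V l.+1).[x] - (V 1).[x] * (V l).[x] / 4.
  by rewrite kE monU_addS.
by rewrite !monUSS monU0 monU1 horner0 hornerC; field.
Qed.

(** The second relation at N turns into the first one at N + 1 by the recurrence and
    (a); the derivative of the recurrence together with (b) yields the second one at
    N + 1. *)
Lemma structure_relation N :
  PhiP F k * (p N)^`() = NS N * p N + MS N * p N.+1 /\
  PhiP F k * (p N.+1)^`() = (Gpoly - NS N) * p N.+1 - gam N.+1 *: (MS N.+1 * p N).
Proof.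
elim: N => [|N [IH0 IH1]].
  rewrite p0 p1 -(polyC1 F) derivC derivX !mulr1 mulr0 NS0; split; first by ring.
  by rewrite {1}PhiP0 NS0.
have S1 : PhiP F k * (p N.+1)^`() = NS N.+1 * p N.+1 + MS N.+1 * p N.+2.
  by rewrite IH1 pS -(MS_NS N) -!mul_polyC; ring.
split=> //; rewrite pS derivB derivM derivX derivZ mul1r -!mul_polyC.
have := PhiP_MS_NS N; move/eqP; rewrite -subr_eq0 => /eqP B.
rewrite -!mul_polyC in B.
transitivity (PhiP F k * p N.+1 + 'X * (PhiP F k * (p N.+1)^`())
  - (gam N.+1)%:P * (PhiP F k * (p N)^`()) - 0 * p N.+1).
  by ring.
rewrite S1 IH0 pS -!mul_polyC -{1}B -(MS_NS N); ring.
Qed.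

(** The left-hand side changes by - Phi M_(N+1) from N to N + 1, by (a) and (b), as
    Phi Omega_N does by (c). *)
Lemma determinant_relation N :
  (Gpoly - NS N) * NS N + gam N.+1 *: (MS N.+1 * MS N) = PhiP F k * OS N.
Proof.
elim: N => [|N IH].
  by rewrite OS0 PhiP0 NS0 -!mul_polyC; ring.
rewrite OS_step (mulrBr (PhiP F k)) -IH.
have := PhiP_MS_NS N; move/eqP; rewrite -subr_eq0 => /eqP B.
rewrite -!mul_polyC in B *.
transitivity ((Gpoly - NS N) * NS N + (gam N.+1)%:P * (MS N.+1 * MS N) 
  - PhiP F k * MS N.+1 + MS N.+1 * 0); last by ring.
rewrite -{1}B -(MS_NS N); ring.
Qed.

(** The factor 1 - x^2 is nonzero at 0, and the Chebyshev factor has degree k - 1. *)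
Lemma PhiP_neq0 : PhiP F k != 0.
Proof.
have hm m : size (chebU F m) = m.+1.
  suff: size (chebU F m) = m.+1 /\ size (chebU F m.+1) = m.+2 by case.
  elim: m => [|m [IH0 IH1]].
    by rewrite /= size_poly1 size_scale ?size_polyX // pnatr_eq0.
  split=> //; have -> : chebU F m.+2 = 2 *: ('X * chebU F m.+1) - chebU F m by [].
  have s : size (2 *: ('X * chebU F m.+1)) = m.+3.
    by rewrite size_scale ?pnatr_eq0 // mulrC size_mulX ?IH1 // -size_poly_gt0 IH1.
  by rewrite size_polyDl ?s // size_polyN IH0 //; lia.
have [i ->] : {i | k = i.+1} by exists k.-1; lia.
rewrite /PhiP Uhat_monU monUS mulf_neq0 //.
  apply/eqP => /(congr1 (fun q : {poly F} => q.[0])).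
  by rewrite hornerD hornerN hornerXn hornerC horner0 expr0n /= subr0 => /eqP; rewrite oner_eq0.
by rewrite scaler_eq0 invr_eq0 expf_eq0 pnatr_eq0 andbF /= -size_poly_gt0 hm.
Qed.

Lemma sieved_ode n j : (j < k)%N ->
  JP lam k n j * (p (n * k + j)%N)^`(2)
  + KP lam k n j * (p (n * k + j)%N)^`()
  + LP lam k n j * p (n * k + j)%N = 0.
Proof.
move=> jk; set N := (n * k + j)%N; have [h1 h2] := structure_relation N.
have := ode_of_structure PhiP_neq0 h1 h2 (determinant_relation N).
by rewrite /MS /NS /OS /N !seqE.
Qed.

End Coefficients.

(** * Normalization and conclusion *)

Lemma sieve_mul (F : fieldType) (k n : nat) (a b : F) : (0 < k)%N ->
  sieve k (n * k) a b = (a + n%:R) / (b + n%:R).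
Proof. by move=> k0; rewrite /sieve dvdn_mull // mulnK. Qed.

Lemma sieve_other (F : fieldType) (k n j : nat) (a b : F) : (0 < j < k)%N ->
  sieve k (n * k + j) a b = 1.
Proof.
by move=> jk; rewrite /sieve dvdn_addr ?dvdn_mull // gtnNdvd //; case/andP: jk.
Qed.

Section Renormalization.
Variables (F : numFieldType) (lam : F) (k : nat).
Hypotheses (k1 : (1 < k)%N) (hlam : forall m : nat, (0 < m)%N -> 2 * lam + m%:R != 0).

(** A vanishing m + lam would be a vanishing 2 lam + 2 m. *)
Lemma lam_nat_neq0 m : (0 < m)%N -> m%:R + lam != 0.
Proof.
move=> m0; have := @hlam (2 * m)%N; rewrite muln_gt0 m0 natrM -mulrDr addrC.
by move=> /(_ isT); rewrite mulf_eq0 => /norP[].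
Qed.

Lemma pochS (a : F) n : poch a n.+1 = poch a n * (a + n%:R).
Proof. by rewrite /poch big_ord_recr. Qed.

Lemma poch_lam_neq0 n : poch (lam + 1) n != 0.
Proof.
elim: n => [|n IH]; first by rewrite /poch big_ord0 oner_neq0.
rewrite pochS mulf_neq0 // -addrA nat1r addrC; exact: lam_nat_neq0.
Qed.

(** The normalizing factor is chosen to make the recurrence monic. *)
Lemma vartheta_step m :
  vartheta lam k m.+1 * (2 * sieve k m.+1 lam (2 * lam)) = vartheta lam k m.
Proof.
have k0 := ltnW k1; have pow2 n : (2 : F) ^+ n != 0 by rewrite expf_neq0 // pnatr_eq0.
rewrite (divn_eq m.+1 k); set n := (m.+1 %/ k)%N; set j := (m.+1 %% k)%N.
have mE : m.+1 = (n * k + j)%N by rewrite -divn_eq.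
have jk : (j < k)%N by rewrite ltn_mod.
have [j0|jpos] := posnP j; last first.
  have -> : m = (n * k + j.-1)%N by lia.
  rewrite sieve_other ?jpos // /vartheta !divnMDl // !divn_small ?addn0; try lia.
  rewrite -[in LHS](prednK jpos) addnS exprSr.
  by have := poch_lam_neq0 n; have := pow2 (n * k + j.-1)%N => u v; field; rewrite u v.
have [i nE] : {i | n = i.+1}.
  by exists n.-1; rewrite prednK // lt0n; apply/eqP => n0; rewrite n0 j0 in mE.
have e : m = (i * k + k.-1)%N by rewrite nE j0 in mE; lia.
have e1 : (i.+1 * k = m.+1)%N by lia.
rewrite j0 addn0 nE sieve_mul // /vartheta mulnK // e1.
have -> : (m %/ k = i)%N by rewrite e divnMDl // divn_small ?addn0 //; lia.
have := poch_lam_neq0 i; have := lam_nat_neq0 (ltn0Sn i); have := hlam (ltn0Sn i).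
have := pow2 m; rewrite !pochS exprSr -!addrA !nat1r => u v w z.
by field; rewrite z u nat1r v [lam + _]addrC w.
Qed.

(** Turning the recurrence of c into a monic one divides its last coefficient by two
    consecutive factors of [vartheta_step]. *)
Lemma gam_sieve m :
  sieve k m.+2 0 (2 * lam) = 4 * gam lam k m.+2
    * sieve k m.+2 lam (2 * lam) * sieve k m.+1 lam (2 * lam).
Proof.
have k0 := ltnW k1; set n := (m.+2 %/ k)%N; set j := (m.+2 %% k)%N.
have mE : m.+2 = (n * k + j)%N by rewrite -divn_eq.
have jk : (j < k)%N by rewrite ltn_mod.
clearbody n j.
have j0n : (j <= 1)%N -> (0 < n)%N.
  by move=> j1; rewrite lt0n; apply/eqP => n0; rewrite n0 mul0n add0n in mE; lia.
rewrite mE; have [j0|jpos] := posnP j; last have [j1|j1] := ltnP 1 j.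
- have n0 : (0 < n)%N by apply: j0n; rewrite j0.
  have [i nE] : {i | n = i.+1} by exists n.-1; rewrite prednK.
  have -> : m.+1 = (i * k + k.-1)%N by rewrite nE j0 in mE; lia.
  rewrite (@sieve_other _ k i k.-1); last by lia.
  rewrite j0 addn0 !sieve_mul // gam_mul //.
  by field; rewrite hlam // lam_nat_neq0.
- have -> : m.+1 = (n * k + j.-1)%N by lia.
  by rewrite !sieve_other ?gam_other //; try lia; field.
- have e : j = 1 by lia.
  have n0 : (0 < n)%N by apply: j0n; rewrite e.
  have -> : m.+1 = (n * k)%N by lia.
  rewrite e !sieve_other ?k1 // addn1 gam_mulS // sieve_mul // gtn_eqF //.
  by field; rewrite hlam // lam_nat_neq0.
Qed.

Lemma vartheta_gam m :
  vartheta lam k m.+2 * sieve k m.+2 0 (2 * lam) = gam lam k m.+2 * vartheta lam k m.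
Proof. by rewrite gam_sieve -(vartheta_step m) -(vartheta_step m.+1); ring. Qed.

Lemma vartheta0 : vartheta lam k 0 = 1.
Proof. by rewrite /vartheta div0n /poch !big_ord0 expr0 mulr1 divr1. Qed.

End Renormalization.

Theorem theorem5p3 (R : realType) (k : nat) (hk : (3 <= k)%N)
  (lam : R[i]) (hlam : forall m : nat, (0 < m)%N -> lam <> - (m%:R / 2))
  (p : nat -> {poly R[i]}) (hp0 : p 0%N = 1)
  (hp : forall (n : nat) (x : R[i]), (0 < n)%N ->
     (p n).[x] = vartheta lam k n.-1 * sieved_c lam k n x) :
  forall n j : nat, (0 < n)%N -> (j < k)%N ->
    JP lam k n j * (p (n * k + j)%N)^`(2)
    + KP lam k n j * (p (n * k + j)%N)^`()
    + LP lam k n j * p (n * k + j)%N = 0.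
Proof.
have k1 : (1 < k)%N by apply: ltnW.
have hl (m : nat) : (0 < m)%N -> 2 * lam + m%:R != 0.
  move=> m0; apply/eqP => h; apply: (hlam m m0).
  have -> : lam = (2 * lam + m%:R - m%:R) / 2 by field.
  by rewrite h; field.
have hl' := lam_nat_neq0 hl.
have p1 : p 1 = 'X.
  apply: poly_pointwise => x; rewrite hp // vartheta0 hornerX.
  by have [_ -> _] := sieved_c_rec x k1 hl; rewrite mul1r.
have pS N : p N.+2 = 'X * p N.+1 - gam lam k N.+1 *: p N.
  apply: poly_pointwise => x; have [c0 c1 cS] := sieved_c_rec x k1 hl.
  rewrite hornerD hornerN hornerM hornerZ hornerX !(hp _.+1) //= cS.
  rewrite -(vartheta_step k1 hl N) mulrBr.
  have -> : gam lam k N.+1 * (p N).[x] =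
    vartheta lam k N.+1 * sieve k N.+1 0 (2 * lam) * sieved_c lam k N x.
    (* For N = 0 the relation p_0 = c_0 is not of the form vartheta_(N-1) c_N. *)
    case: N => [|N]; last by rewrite hp //= (vartheta_gam k1 hl) mulrA.
    have := vartheta_step k1 hl 0; rewrite vartheta0 /sieve dvdn1 (gtn_eqF k1).
    rewrite c0 hp0 hornerC /gam /= !mulr1 => e.
    have n2 : (2 : R[i]) != 0 by rewrite pnatr_eq0.
    by apply: (mulIf n2); rewrite e; field.
  by ring.
by move=> n j _ jk; exact: (sieved_ode k1 hl' hp0 p1 pS n jk).
Qed.
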